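(* Let $a,d,c$ be real numbers with $a>d>0$ and $c\neq 0$, let $N=2$, $Q=I_2$ and $B=\begin{pmatrix}-a+d&0\\c&-a-d\end{pmatrix}$, and let $\mathcal L=\mathcal L^{Q,B}$ be the associated Ornstein--Uhlenbeck operator on $L^2(\gamma_\infty)$, where $\gamma_\infty$ is its invariant Gaussian probability measure. Then the generalized eigenspaces of $\mathcal L$ are not mutually orthogonal in $L^2(\gamma_\infty)$; that is, there exist two distinct eigenvalues of $\mathcal L$ whose generalized eigenspaces are not orthogonal to each other in $L^2(\gamma_\infty)$.
   Context: Let $Q$ be a real symmetric positive-definite $N\times N$ matrix and $B$ a real $N\times N$ matrix whose eigenvalues have negative real parts. For $t\in(0,+\infty]$ put $Q_t=\int_0^t e^{sB}Qe^{sB^*}\,ds$ (symmetric and positive definite) and let $\gamma_t$ be the Gaussian probability measure $d\gamma_t(x)=(2\pi)^{-N/2}(\det Q_t)^{-1/2}e^{-\frac12\langle Q_t^{-1}x,x\rangle}\,dx$ on $\mathbb R^N$. The Ornstein--Uhlenbeck semigroup is $\mathcal H_t f(x)=\int f(e^{tB}x-y)\,d\gamma_t(y)$, $t>0$, defined for bounded continuous $f$ and extended to $L^2(\gamma_\infty)$ (complex-valued functions); $\gamma_\infty$ is its unique invariant probability measure. The Ornstein--Uhlenbeck operator $\mathcal L=\mathcal L^{Q,B}$ is the infinitesimal generator of $(\mathcal H_t)_{t>0}$ on $L^2(\gamma_\infty)$; on Schwartz functions it is given by $\mathcal L f(x)=\frac12\operatorname{tr}(Q\nabla^2 f)(x)+\langle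 Bx,\nabla f(x)\rangle$, where $\nabla$ is the gradient and $\nabla^2$ the Hessian. A generalized eigenfunction of $\mathcal L$ with eigenvalue $\mu\in\mathbb C$ is a nonzero $u\in L^2(\gamma_\infty)$ (in the domain of the relevant power of $\mathcal L$) such that $(\mathcal L-\mu I)^k u=0$ for some positive integer $k$; the generalized eigenspace corresponding to $\mu$ is the span of these $u$. *)

(* Defs.v *)
From HB Require Import structures.
From mathcomp Require Import all_boot all_order all_algebra.
From mathcomp Require Import all_classical all_reals all_analysis.
From mathcomp Require Import measurable_realfun complex.

Set Implicit Arguments.
Unset Strict Implicit.
Unset Printing Implicit Defensive.

Import Order.TTheory GRing.Theory Num.Theory.
Import numFieldNormedType.Exports.

Local Open Scope classical_set_scope.
Local Open Scope ring_scope.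
Local Open Scope complex_scope.
Local Open Scope Lnorm_scope.

(** Ornstein-Uhlenbeck semigroups on the plane, whose points are pairs, with
    the product of two copies of Lebesgue measure. Matrices act on columns. *)

(** [measurableTypeR R] is [R] with the Borel sets on which Lebesgue measure is
    defined; it is convertible to [R]. *)
Notation plane R := (measurableTypeR R * measurableTypeR R)%type.

Definition col2 {R : realType} (x : R * R) : 'cV[R]_2 :=
  \col_(i < 2) (if i == 0 then x.1 else x.2).

Definition pair2 {R : realType} (v : 'cV[R]_2) : R * R := (v 0 0, v 1 0).

Definition mx2 {R : realType} (p q r s : R) : 'M[R]_2 :=
  \matrix_(i < 2, j < 2)
    if i == 0 then (if j == 0 then p else q) else (if j == 0 then r else s).

Definition leb2 {R : realType} : {measure set (plane R) -> \bar R} :=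
  (@lebesgue_measure R \x @lebesgue_measure R)%E.

Definition expmx {R : realType} (A : 'M[R]_2) : 'M[R]_2 :=
  lim (series (fun k : nat => k`!%:R^-1 *: A ^+ k) @ \oo).

(** [Q_t], the integral of [e^{sB} Q e^{sB^*}] over [0 <= s <= t], taken
    entrywise; [t = +oo] gives the half-line. *)
Definition OU_cov {R : realType} (Q B : 'M[R]_2) (t : \bar R) : 'M[R]_2 :=
  \matrix_(i < 2, j < 2)
    \int[lebesgue_measure]_(s in [set s : R | 0 <= s /\ (s%:E <= t)%E])
      (expmx (s *: B) *m Q *m expmx (s *: B^T)) i j.

(** Density of the centered Gaussian law of covariance [S]; the factor
    [(2 pi)^(- N / 2)] is [(2 pi)^-1] here. *)
Definition gauss_pdf {R : realType} (S : 'M[R]_2) (x : R * R) : R :=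
  (2 * pi)^-1 * (Num.sqrt (\det S))^-1 *
  expR (- 2^-1 * ((col2 x)^T *m invmx S *m col2 x) 0 0).

Definition gauss_measure {R : realType} (S : 'M[R]_2) :
    set (plane R) -> \bar R :=
  fun A => (\int[leb2]_(x in A) (gauss_pdf S x)%:E)%E.

Section gauss_measure_isMeasure.
Context {R : realType} (S : 'M[R]_2).

Lemma gauss_pdf_ge0 x : 0 <= gauss_pdf S x.
Proof.
by rewrite /gauss_pdf !mulr_ge0 ?invr_ge0 ?sqrtr_ge0 ?expR_ge0 ?mulr_ge0 ?pi_ge0.
Qed.

Lemma measurable_gauss_pdf : measurable_fun [set: plane R] (gauss_pdf S).
Proof.
apply: measurable_funM; first exact: measurable_cst.
apply: measurableT_comp; first exact: measurable_expR.
apply: measurable_funM; first exact: measurable_cst.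
pose A := invmx S.
have -> : (fun x : R * R => ((col2 x)^T *m A *m col2 x) 0 0) =
    (fun x => (x.1 * A 0 0 + x.2 * A 1 0) * x.1 +
              (x.1 * A 0 1 + x.2 * A 1 1) * x.2).
  apply/funext => x; rewrite !mxE !big_ord_recl !big_ord0 !mxE/=.
  rewrite !big_ord_recl !big_ord0 !mxE/= !addr0.
  have -> : lift ord0 ord0 = 1 :> 'I_2 by apply/val_inj.
  by [].
have m1 : measurable_fun [set: plane R] (fun x : plane R => x.1).
  exact: measurable_fst.
have m2 : measurable_fun [set: plane R] (fun x : plane R => x.2).
  exact: measurable_snd.
have mk (k : R) : measurable_fun [set: plane R] (fun=> k).
  exact: measurable_cst.
by repeat first [apply: measurable_funD | apply: measurable_funM].
Qed.

Let gauss0 : gauss_measure S set0 = 0%E.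
Proof. exact: integral_set0. Qed.

Let gauss_ge0 A : (0 <= gauss_measure S A)%E.
Proof. by apply: integral_ge0 => x _; rewrite lee_fin gauss_pdf_ge0. Qed.

Let gauss_sigma_additive : semi_sigma_additive (gauss_measure S).
Proof.
move=> F mF tF mUF.
rewrite /gauss_measure ge0_integral_bigcup//; last 2 first.
- apply/measurable_EFinP; apply: measurable_funTS.
  exact: measurable_gauss_pdf.
- by move=> x _; rewrite lee_fin gauss_pdf_ge0.
apply: is_cvg_nneseries_cond => n _ _.
by apply: integral_ge0 => x _; rewrite lee_fin gauss_pdf_ge0.
Qed.

HB.instance Definition _ := isMeasure.Build _ _ _
  (gauss_measure S) gauss0 gauss_ge0 gauss_sigma_additive.

End gauss_measure_isMeasure.

Definition OU_gamma {R : realType} (Q B : 'M[R]_2) (t : \bar R) :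
    {measure set (plane R) -> \bar R} :=
  gauss_measure (OU_cov Q B t).

(** Complex-valued [L^2]: its elements are represented by functions, and
    identities between them hold almost everywhere. *)
Section complex_L2.
Context {R : realType} (mu : {measure set (plane R) -> \bar R}).
Implicit Types u v : plane R -> R[i].

Definition Cintegral u : R[i] :=
  (\int[mu]_x complex.Re (u x))%R +i* (\int[mu]_x complex.Im (u x))%R.

Definition L2norm u : \bar R :=
  'N[mu]_2%:E [(fun x => (ComplexField.Normc.normc (u x))%:E)].

Definition inL2 u : Prop :=
  [/\ measurable_fun setT (fun x => complex.Re (u x)),
      measurable_fun setT (fun x => complex.Im (u x)) &
      (L2norm u < +oo)%E].

Definition inner u v : R[i] := Cintegral (fun x => u x * conjc (v x)).

Definition orthogonal_subspaces (U V : set (plane R -> R[i])) : Prop :=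
  forall u v, U u -> V v -> inner u v = 0.

(** An unbounded operator on [L^2] is given by its graph: [A u v] reads
    "[u] is in the domain of [A] and [A u = v]". *)
Implicit Types A : (plane R -> R[i]) -> (plane R -> R[i]) -> Prop.

Definition nonzero u : Prop := ~ (\forall x \ae mu, u x = 0).

Definition is_eigenvalue A (m : R[i]) : Prop :=
  exists u, [/\ inL2 u, nonzero u & A u (fun x => m * u x)].

(** Graph of [(A - m I)^k]. *)
Fixpoint shift_pow A (m : R[i]) (k : nat) u v : Prop :=
  if k is k'.+1 then
    exists w, A u w /\ shift_pow A m k' (fun x => w x - m * u x) v
  else inL2 u /\ (\forall x \ae mu, u x = v x).

Definition gen_eigenfunction A (m : R[i]) u : Prop :=
  [/\ inL2 u, nonzero u &
      exists k : nat, (0 < k)%N /\ shift_pow A m k u (fun=> 0)].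

Definition gen_eigenspace A (m : R[i]) : set (plane R -> R[i]) :=
  [set u | inL2 u /\
    exists (n : nat) (c : 'I_n -> R[i]) (e : 'I_n -> plane R -> R[i]),
      (forall i, gen_eigenfunction A m (e i)) /\
      \forall x \ae mu, u x = \sum_(i < n) c i * e i x].

End complex_L2.

Definition bounded_continuous {R : realType} (f : R * R -> R[i]) : Prop :=
  [/\ continuous (fun x => complex.Re (f x)),
      continuous (fun x => complex.Im (f x)) &
      exists M : R, forall x, ComplexField.Normc.normc (f x) <= M].

Section OU.
Context {R : realType} (Q B : 'M[R]_2).
Implicit Types f g : plane R -> R[i].

Let gamma_oo := OU_gamma Q B +oo%E.

Definition OU_Cb (t : R) f (x : plane R) : R[i] :=
  Cintegral (OU_gamma Q B t%:E)
    (fun y => f (pair2 (expmx (t *: B) *m col2 x) - y)).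

(** The continuous extension of [OU_Cb t] to [L^2(gamma_oo)]: [OU_L2 t f g]
    reads "[H_t f = g]". Bounded continuous functions are dense and [OU_Cb t]
    contracts the norm, so the graph is reached by sequences. *)
Definition OU_L2 (t : R) f g : Prop :=
  [/\ inL2 gamma_oo f, inL2 gamma_oo g &
      exists h : nat -> plane R -> R[i],
        [/\ forall n, bounded_continuous (h n),
            L2norm gamma_oo (fun x => h n x - f x) @[n --> \oo] --> 0%E &
            L2norm gamma_oo (fun x => OU_Cb t (h n) x - g x)
              @[n --> \oo] --> 0%E]].

(** The infinitesimal generator: [OU_operator f g] reads "[f] is in its domain
    and [g] is its value at [f]", that is, [(H_t f - f) / t] tends to [g] in
    [L^2(gamma_oo)] as [t] tends to [0] from above. *)
Definition OU_operator f g : Prop :=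
  [/\ inL2 gamma_oo f, inL2 gamma_oo g &
      exists F : R -> plane R -> R[i],
        (forall t : R, 0 < t -> OU_L2 t f (F t)) /\
        L2norm gamma_oo (fun x => (t^-1)%:C * (F t x - f x) - g x)
          @[t --> 0^'+] --> 0%E].

End OU.

(* Main.v *)
From HB Require Import structures.
Require Import Defs.
From mathcomp Require Import all_boot all_order all_algebra.
From mathcomp Require Import all_classical all_reals all_analysis.
From mathcomp Require Import measurable_realfun complex ring lra.

Set Implicit Arguments.
Unset Strict Implicit.
Unset Printing Implicit Defensive.

Import Order.TTheory GRing.Theory Num.Theory.
Import numFieldNormedType.Exports.

Local Open Scope classical_set_scope.
Local Open Scope ring_scope.
Local Open Scope complex_scope.

(** Linear forms are enough to see that orthogonality fails. If [v] is a left
    eigenvector of [B] with eigenvalue [l], then the form [x |-> <v, x>]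
    satisfies [<v, e^{tB} x> = e^{lt} <v, x>], and the
    integral of [<v, y>] against the centered law [gamma_t] is zero, so [H_t]
    multiplies the form by [e^{lt}] and the generator multiplies it by [l] ([OU_operator_lin]).

    With [p = - a + d], [q = - a - d] and [k = c / (2 d)] the matrix [B] is
    [(p, 0; k (p - q), q)]. Its left eigenvectors [(1, 0)] and [(- k, 1)], for
    the distinct eigenvalues [p] and [q], give the eigenfunctions [x_1] and
    [x_2 - k x_1]. Let [G], [H], [K] be the integrals over [0 <= s <= t] of
    [e^{2ps}], [e^{(p+q)s}], [e^{2qs}]. The covariance [Q_t] has first row
    [(G, k (G - H))] ([OU_cov_low]), so the regression coefficient of [x_2] on
    [x_1] is [k (G - H) / G]; hence, for [t = +oo], the inner product of the
    two eigenfunctions is [- k H / G] times the variance of [x_1]. Neither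
    factor vanishes, because [H > 0] and [c != 0]
    ([integral_low_eigenfunctions_neq0]). No explicit value of the three
    integrals is needed: Cauchy-Schwarz, [H^2 <= G K], gives the positive
    definiteness of [Q_t] for every [t] in [(0, +oo]] at once ([OU_cov_det]).

    A linear form is not bounded, while the semigroup is defined on bounded
    continuous functions and extended by density. Here the approximation is
    explicit: [z / (1 + e |z|)] is bounded and differs from [z] by at most
    [e z^2]. Integrating this error against [gamma_t] leaves [e] times a
    quadratic polynomial in [x], whose norm in [L^2(gamma_oo)] is finite
    because Gaussian fourth moments are ([OU_L2_lin]). *)

(** * Exponentials of triangular 2 x 2 matrices *)

Section expmx.
Context {R : realType}.
Implicit Types (A B P : 'M[R]_2) (p q s : R).

(** [P] and [P'] are complementary spectral projections of [A], so
    [A^k = p^k P + q^k P'] and the exponential series splits into two scalar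
    ones. *)
Lemma expmx_spectral A P P' p q : P + P' = 1%:M -> A *m P = p *: P ->
  A *m P' = q *: P' -> expmx A = expR p *: P + expR q *: P'.
Proof.
move=> PP' AP AP'.
have pow k : A ^+ k = p ^+ k *: P + q ^+ k *: P'.
  elim: k => [|k IH]; first by rewrite !expr0 !scale1r PP'.
  rewrite exprS IH mulrDr -!scalerAr -![A * _]/(A *m _) AP AP' !scalerA.
  by rewrite -!exprSr.
have cv r P0 : series (exp_coeff r) n *: P0 @[n --> \oo] --> expR r *: P0.
  apply: cvgZr_tmp; exact: is_cvg_series_exp_coeff.
rewrite /expmx; apply: cvg_lim => //.
have -> : series (fun k => k`!%:R^-1 *: A ^+ k) =
    (fun n => series (exp_coeff p) n *: P + series (exp_coeff q) n *: P').
  apply/funext => n; rewrite /series/= !scaler_suml -big_split/=.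
  apply: eq_bigr => k _; rewrite pow scalerDr !scalerA /exp_coeff/=.
  by rewrite ![_^-1 * _]mulrC.
exact: cvgD.
Qed.

Lemma eq_mx2 A B : A 0 0 = B 0 0 -> A 0 1 = B 0 1 -> A 1 0 = B 1 0 ->
  A 1 1 = B 1 1 -> A = B.
Proof.
move=> e00 e01 e10 e11; apply/matrixP => i j.
have I2 (k : 'I_2) : k = 0 \/ k = 1.
  by case: k => [[|[|//]] ?]; [left|right]; exact: val_inj.
by case: (I2 i) => ->; case: (I2 j) => ->.
Qed.

Lemma mulmx2 p q r s p' q' r' s' : mx2 p q r s *m mx2 p' q' r' s' =
  mx2 (p * p' + q * r') (p * q' + q * s') (r * p' + s * r') (r * q' + s * s').
Proof.
by apply: eq_mx2; rewrite !mxE !big_ord_recl big_ord0 !mxE/= addr0.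
Qed.

Lemma addmx2 p q r s p' q' r' s' : mx2 p q r s + mx2 p' q' r' s' =
  mx2 (p + p') (q + q') (r + r') (s + s').
Proof. by apply: eq_mx2; rewrite !mxE. Qed.

Lemma scalemx2 k p q r s : k *: mx2 p q r s = mx2 (k * p) (k * q) (k * r) (k * s).
Proof. by apply: eq_mx2; rewrite !mxE. Qed.

Lemma trmx2 p q r s : (mx2 p q r s)^T = mx2 p r q s.
Proof. by apply: eq_mx2; rewrite !mxE. Qed.

Lemma mx2_1 : 1%:M = mx2 1 0 0 1 :> 'M[R]_2.
Proof. by apply: eq_mx2; rewrite !mxE. Qed.

Lemma det_mx2 p q r s : \det (mx2 p q r s) = p * s - q * r.
Proof.
by rewrite (expand_det_row _ 0) !big_ord_recl big_ord0 /cofactor !det_mx11 !mxE/=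
  expr0 expr1 mul1r mulN1r addr0 mulrN.
Qed.

Section triangular.
Variables (p q k : R).

(** The lower left entry is normalized by [p - q] so that the spectral
    projections do not involve a division. *)
Definition lowmx : 'M[R]_2 := mx2 p 0 (k * (p - q)) q.

Lemma expmx_low s : expmx (s *: lowmx) =
  mx2 (expR (p * s)) 0 (k * (expR (p * s) - expR (q * s))) (expR (q * s)).
Proof.
rewrite (@expmx_spectral _ (mx2 1 0 k 0) (mx2 0 0 (- k) 1) (p * s) (q * s));
  rewrite /lowmx ?mx2_1 ?scalemx2 ?addmx2 ?mulmx2 ?scalemx2; f_equal; ring.
Qed.

Lemma expmx_lowT s : expmx (s *: lowmx^T) =
  mx2 (expR (p * s)) (k * (expR (p * s) - expR (q * s))) 0 (expR (q * s)).
Proof.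
rewrite (@expmx_spectral _ (mx2 1 k 0 0) (mx2 0 (- k) 0 1) (p * s) (q * s));
  rewrite /lowmx ?mx2_1 ?trmx2 ?scalemx2 ?addmx2 ?mulmx2 ?scalemx2; f_equal; ring.
Qed.
End triangular.
End expmx.

(** * The covariance matrices *)

Section cov.
Context {R : realType}.
Implicit Types (p q k r s : R) (t : \bar R).

(** The domain of integration of [OU_cov]; it allows [t = +oo]. *)
Definition times t : set (measurableTypeR R) := [set s : R | 0 <= s /\ (s%:E <= t)%E].

Lemma measurable_times t : measurable (times t).
Proof.
case: t => [t| |].
- rewrite (_ : times _ = `[0, t]%classic); first exact: measurable_itv.
  by apply/seteqP; split => s; rewrite /times /= in_itv/= lee_fin => /andP.
- rewrite (_ : times _ = `[0, +oo[%classic); first exact: measurable_itv.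
  by apply/seteqP; split => s; rewrite /times /= in_itv/= andbT leey => // -[].
- rewrite (_ : times _ = set0); first exact: measurable0.
  by apply/seteqP; split => s // -[].
Qed.

Definition expint t r : R := \int[lebesgue_measure]_(s in times t) expR (r * s).

(** Up to the factor [- r], the integrand is the density of an exponential
    law. *)
Lemma integrable_expR t r : r < 0 ->
  (@lebesgue_measure R).-integrable (times t) (fun s => (expR (r * s))%:E).
Proof.
move=> r0; have Nr0 : 0 < - r by rewrite oppr_gt0.
have m0 : measurable (`[0%R, +oo[%classic : set (measurableTypeR R)).
  exact: measurable_itv.
have int0 := integrableZl m0 (- r)^-1 (integrableS measurableT m0
  (@subsetT _ _) (integrable_exponential_pdf Nr0)).
have {}int0 : (@lebesgue_measure R).-integrable `[0%R, +oo[ (fun s => (expR (r * s))%:E).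
  apply: eq_integrable int0 => // s /[!inE]/= /[!in_itv]/= /[!andbT] s0.
  by rewrite exponential_pdfE// opprK -EFinM mulKf// gt_eqF.
apply: integrableS int0 => //; first exact: measurable_times.
by move=> s [s0 _]; rewrite /= in_itv/= s0.
Qed.

Lemma expint_gt0 t r : (0 < t)%E -> r < 0 -> 0 < expint t r.
Proof.
move=> t0 r0.
have [u [u0 ut]] : exists u : R, 0 < u /\ (u%:E <= t)%E.
  by case: t t0 => [t| |] //= t0; [exists t|exists 1; rewrite leey].
apply: fine_gt0; apply/andP; split; last first.
  have := integrable_fin_num (measurable_times t) (integrable_expR t r0).
  by rewrite fin_numE => /andP[_]; rewrite -ltey.
apply: (@lt_le_trans _ _ (\int[lebesgue_measure]_(s in `[0%R, u]) (expR (r * u))%:E)%E).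
  rewrite integral_cst//= lebesgue_measure_itv/= lte_fin u0 oppr0 adde0.
  by rewrite -EFinM lte_fin mulr_gt0// expR_gt0.
apply: (@le_trans _ _ (\int[lebesgue_measure]_(s in `[0%R, u]) (expR (r * s))%:E)%E).
  apply: ge0_le_integral => //.
  - by apply/measurable_EFinP/measurableT_comp => //; exact: measurable_funM.
  - move=> s; rewrite /= in_itv/= => /andP[_ su].
    by rewrite lee_fin ler_expR ler_wnM2l// ltW.
apply: ge0_subset_integral => //.
- exact: measurable_times.
- exact: measurable_int (integrable_expR t r0).
- move=> s; rewrite /= in_itv/= => /andP[s0 su]; split => //.
  by rewrite (le_trans _ ut)// lee_fin.
Qed.

Lemma Rintegral_expR3 t p q x y z : p < 0 -> q < 0 ->
  \int[lebesgue_measure]_(s in times t)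
    (x * expR ((p + p) * s) + y * expR ((p + q) * s) + z * expR ((q + q) * s)) =
  x * expint t (p + p) + y * expint t (p + q) + z * expint t (q + q).
Proof.
move=> p0 q0; have mt := measurable_times t.
have iZ w r : r < 0 -> (@lebesgue_measure R).-integrable (times t)
    (EFin \o (fun s => w * expR (r * s))).
  by move=> r0; have := integrableZl mt w (integrable_expR t r0).
have ipp : p + p < 0 by lra.
have ipq : p + q < 0 by lra.
have iqq : q + q < 0 by lra.
rewrite RintegralD//=; last 2 first.
- have := integrableD mt (iZ x _ ipp) (iZ y _ ipq); exact.
- exact: iZ.
rewrite RintegralD//=; [|exact: iZ..].
by rewrite !RintegralZl//; exact: integrable_expR.
Qed.

(** Cauchy-Schwarz for [e^{ps}] and [e^{qs}], by integrating the square of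
    [K e^{ps} - H e^{qs}]. *)
Lemma expint_CS t p q : (0 < t)%E -> p < 0 -> q < 0 ->
  expint t (p + q) ^+ 2 <= expint t (p + p) * expint t (q + q).
Proof.
move=> t0 p0 q0.
set G := expint t (p + p); set H := expint t (p + q); set K := expint t (q + q).
have K0 : 0 < K by rewrite expint_gt0//; lra.
have : 0 <= \int[lebesgue_measure]_(s in times t)
    (K ^+ 2 * expR ((p + p) * s) + (- 2 * K * H) * expR ((p + q) * s) +
     H ^+ 2 * expR ((q + q) * s)).
  apply: Rintegral_ge0 => s _; rewrite !mulrDl !expRD.
  set E := expR (p * s); set F := expR (q * s).
  by rewrite (_ : _ + _ = (K * E - H * F) ^+ 2) ?sqr_ge0//; ring.
rewrite Rintegral_expR3// -/G -/H -/K.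
rewrite (_ : _ + _ = K * (G * K - H ^+ 2)); last by ring.
by rewrite pmulr_rge0// subr_ge0.
Qed.

Lemma OU_cov_low t p q k : (0 < t)%E -> p < 0 -> q < 0 ->
  let G := expint t (p + p) in
  let H := expint t (p + q) in
  let K := expint t (q + q) in
  OU_cov 1%:M (lowmx p q k) t =
  mx2 G (k * (G - H)) (k * (G - H)) (k ^+ 2 * (G - 2 * H + K) + K).
Proof.
move=> t0 p0 q0 G H K.
(* The coefficients of [e^{2ps}], [e^{(p+q)s}] and [e^{2qs}] in the integrand. *)
pose x : 'M[R]_2 := mx2 1 k k (k ^+ 2).
pose y : 'M[R]_2 := mx2 0 (- k) (- k) (- 2 * k ^+ 2).
pose z : 'M[R]_2 := mx2 0 0 0 (k ^+ 2 + 1).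
have -> : OU_cov 1%:M (lowmx p q k) t = G *: x + H *: y + K *: z.
  apply/matrixP => i j; rewrite /OU_cov [LHS]mxE.
  have lin (u v w : R) (X Y Z : 'M[R]_2) : (u *: X + v *: Y + w *: Z) i j =
      X i j * u + Y i j * v + Z i j * w by rewrite !mxE; ring.
  transitivity (\int[lebesgue_measure]_(s in times t)
    (x i j * expR ((p + p) * s) + y i j * expR ((p + q) * s) +
     z i j * expR ((q + q) * s))).
    apply: eq_Rintegral => s _.
    rewrite mulmx1 expmx_low expmx_lowT mulmx2 !mulrDl !expRD -lin.
    congr (fun_of_matrix _ i j).
    by rewrite /x /y /z !scalemx2 !addmx2; f_equal; ring.
  by rewrite Rintegral_expR3// -lin.
by rewrite /x /y /z !scalemx2 !addmx2; f_equal; ring.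
Qed.

(** The determinant equals [k^2 (G K - H^2) + G K]. *)
Lemma OU_cov_det t p q k : (0 < t)%E -> p < 0 -> q < 0 ->
  let G := expint t (p + p) in
  let H := expint t (p + q) in
  let K := expint t (q + q) in
  is_true (0 < G * (k ^+ 2 * (G - 2 * H + K) + K) - (k * (G - H)) ^+ 2).
Proof.
move=> t0 p0 q0 G H K.
have G0 : 0 < G by rewrite expint_gt0//; lra.
have K0 : 0 < K by rewrite expint_gt0//; lra.
rewrite (_ : _ - _ = k ^+ 2 * (G * K - H ^+ 2) + G * K); last by ring.
rewrite ltr_wpDl ?mulr_gt0// mulr_ge0 ?sqr_ge0// subr_ge0; exact: expint_CS.
Qed.
End cov.

(** * Integration against a density and reflections *)

Section density.
Local Open Scope ereal_scope.
Context d (T : measurableType d) (R : realType).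
Variables (mu nu : {measure set T -> \bar R}) (p : T -> R).
Hypothesis p0 : forall x, (0 <= p x)%R.
Hypothesis mp : measurable_fun setT p.
Hypothesis nuE : forall A, measurable A -> nu A = \int[mu]_(x in A) (p x)%:E.

Let mEp : measurable_fun setT (EFin \o p). Proof. exact/measurable_EFinP. Qed.

Import HBNNSimple.

Let nnsfun_density (h : {nnsfun T >-> R}) :
  \int[nu]_x (h x)%:E = \int[mu]_x ((h x)%:E * (p x)%:E).
Proof.
have mind r : measurable_fun setT (fun x => (r * \1_(h @^-1` [set r]) x)%:E).
  by apply/measurable_EFinP; exact: measurable_funM.
have ind0 r x : 0 <= (r * \1_(h @^-1` [set r]) x)%:E.
  exact: nnfun_muleindic_ge0.
transitivity (\sum_(r \in range h) r%:E * nu (h @^-1` [set r])).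
  by rewrite integralT_nnsfun sintegralE.
under [RHS]eq_integral => x _.
  rewrite (fimfunE h x) -fsumEFin// ge0_mule_fsuml//; over.
rewrite ge0_integral_fsum//; last 2 first.
- by move=> r; apply: emeasurable_funM.
- by move=> r x _; rewrite mule_ge0// lee_fin.
apply: eq_fsbigr => r /[!inE] -[x _ <-].
under eq_integral do rewrite EFinM -muleA.
rewrite ge0_integralZl//; last 3 first.
- by apply: emeasurable_funM => //; exact/measurable_EFinP.
- by move=> y _; rewrite mule_ge0// lee_fin.
- by rewrite lee_fin.
congr (_ * _); rewrite nuE// integral_mkcond.
by apply: eq_integral => y _; rewrite epatch_indic muleC.
Qed.

(** The hypothesis [nuE] is the case of indicators; simple functions and
    monotone convergence give the rest. *)
Lemma ge0_integral_density (f : T -> \bar R) : measurable_fun setT f ->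
  (forall x, 0 <= f x) -> \int[nu]_x f x = \int[mu]_x (f x * (p x)%:E).
Proof.
move=> mf f0; pose h := nnsfun_approx measurableT mf.
have hf x : (h n x)%:E @[n --> \oo] --> f x by exact: cvg_nnsfun_approx.
have ndh x : {homo (fun n => (h n x)%:E) : m n / (m <= n)%N >-> m <= n}.
  by move=> m n mn; rewrite lee_fin; exact/lefP/nd_nnsfun_approx.
transitivity (limn (fun n => \int[nu]_x (h n x)%:E)).
  rewrite -monotone_convergence//.
  - by apply: eq_integral => x _; exact/esym/cvg_lim.
  - by move=> n; exact/measurable_EFinP.
  - by move=> n x _; rewrite lee_fin.
under eq_fun do rewrite nnsfun_density.
rewrite -monotone_convergence//.
- by apply: eq_integral => x _; apply/cvg_lim => //; exact: cvgeZr.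
- by move=> n; apply: emeasurable_funM => //; exact/measurable_EFinP.
- by move=> n x _; rewrite mule_ge0// lee_fin.
- by move=> x _ m n mn; rewrite lee_wpmul2r ?lee_fin//; exact/lefP/nd_nnsfun_approx.
Qed.

End density.

Section odd.
Local Open Scope ereal_scope.
Context d (T : measurableType d) (R : realType) (mu : {measure set T -> \bar R}).

(** A symmetry exchanges the positive and the negative part of an odd function.
    Invariance is asked for nonnegative functions only, where it follows from
    the theorem of Tonelli without integrability conditions. *)
Lemma integral_odd (tau : T -> T) (g : T -> \bar R) :
  (forall f, measurable_fun setT f -> (forall x, 0 <= f x) ->
    \int[mu]_x f (tau x) = \int[mu]_x f x) ->
  mu.-integrable setT g -> (forall x, g (tau x) = - g x) ->
  \int[mu]_x g x = 0.
Proof.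
move=> inv ig odd; have mg := measurable_int _ ig.
have eqpn : \int[mu]_x g^\+ x = \int[mu]_x g^\- x.
  rewrite -(inv g^\+); [|exact: measurable_funepos|by []].
  by apply: eq_integral => x _; rewrite funeposE funenegE odd.
rewrite integralE eqpn subee//.
by apply: integrable_fin_num => //; exact: integrable_funeneg.
Qed.
End odd.

Section reflect.
Context {R : realType}.
Local Notation mu := (@lebesgue_measure R).

Lemma ge0_integral_reflect (k : R) (f : measurableTypeR R -> \bar R) :
  measurable_fun setT f -> (forall x, (0 <= f x)%E) ->
  (\int[mu]_x f (k - x)%R = \int[mu]_x f x)%E.
Proof.
move=> mf f0; pose phi (x : R) : R := k - x.
have mphi : measurable_fun setT (phi : measurableTypeR R -> measurableTypeR R).
  exact: measurable_funB.
rewrite -[LHS](ge0_integral_pushforward mphi mu measurableT mf)//.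
apply: eq_measure_integral => A mA _; apply/esym/lebesgue_measure_unique => //.
move=> _ [[a b]] _ <-.
have swap (x : R) : (a < k - x <= b) = (k - b <= x < k - a).
  by apply/idP/idP => /andP[? ?]; apply/andP; split; lra.
rewrite [RHS](_ : _ = mu `[k - b, k - a[%classic); last first.
  congr (mu _); apply/seteqP.
  by split => x; rewrite /phi /= !in_itv/= swap.
rewrite !lebesgue_measure_itv/= !lte_fin ltrD2l ltrN2.
by case: ifP => // _; rewrite -!EFinB; congr EFin; ring.
Qed.

End reflect.

(** * Gaussian measures on the plane *)

Section gauss.
Context {R : realType}.
Variables (s u w : R).
Hypotheses (s0 : 0 < s) (D0 : 0 < s * w - u * u).
Let D := s * w - u * u.
Let S := mx2 s u u w.
Local Notation mu := (@lebesgue_measure R).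

(** The quadratic form of the inverse covariance matrix. *)
Definition qform (x : plane R) : R :=
  (w * x.1 ^+ 2 - 2 * u * (x.1 * x.2) + s * x.2 ^+ 2) / D.

Lemma gauss_pdfE (x : plane R) : gauss_pdf S x =
  (2 * pi)^-1 * (Num.sqrt D)^-1 * expR (- 2^-1 * qform x).
Proof.
rewrite /gauss_pdf det_mx2; congr (_ * expR (_ * _)).
have Dn0 : D != 0 by rewrite gt_eqF.
have SV : S *m mx2 (w / D) (- u / D) (- u / D) (s / D) = 1%:M.
  by rewrite mulmx2 mx2_1; f_equal; rewrite /D in Dn0 *; field.
have Su : S \in unitmx by case: (mulmx1_unit SV).
have -> : invmx S = mx2 (w / D) (- u / D) (- u / D) (s / D).
  by rewrite -[RHS]mul1mx -(mulVmx Su) -mulmxA SV mulmx1.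
rewrite !mxE !big_ord_recl big_ord0 !mxE/= !big_ord_recl !big_ord0 !mxE/=.
by rewrite /qform; ring.
Qed.

(** Completing the square: the second coordinate, given the first one, is normal
    with mean [u / s * x.1] and variance [D / s]. *)
Lemma gauss_pdf_disintegrate (x : plane R) : gauss_pdf S x =
  normal_pdf 0 (Num.sqrt s) x.1 *
  normal_pdf (u / s * x.1) (Num.sqrt (D / s)) x.2.
Proof.
have Ds0 : 0 < D / s by rewrite divr_gt0.
rewrite gauss_pdfE !normal_pdfE ?gt_eqF ?sqrtr_gt0// /normal_peak /normal_fun.
rewrite !sqr_sqrtr ?ltW// mulrACA -expRD -invfM -[in RHS]invfM; congr (_^-1 * expR _).
  rewrite -[in RHS]sqrtrM; last by rewrite mulrn_wge0// mulr_ge0 ?pi_ge0// ltW.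
  rewrite (_ : s * pi *+ 2 * _ = (2 * pi) ^+ 2 * D).
    by rewrite sqrtrM ?sqr_ge0// sqrtr_sqr ger0_norm// mulr_ge0// pi_ge0.
  by field; rewrite gt_eqF.
rewrite /qform /D; field.
by rewrite !gt_eqF.
Qed.

(** [s * qform x - x.1 ^+ 2] and [w * qform x - x.2 ^+ 2] are squares divided
    by the determinant. *)
Lemma qform_ub (x : plane R) : x.1 ^+ 2 + x.2 ^+ 2 <= (s + w) * qform x.
Proof.
have Dn0 : D != 0 by rewrite gt_eqF.
have e1 : s * qform x - x.1 ^+ 2 = (s * x.2 - u * x.1) ^+ 2 / D.
  by rewrite /qform /D; field.
have e2 : w * qform x - x.2 ^+ 2 = (w * x.1 - u * x.2) ^+ 2 / D.
  by rewrite /qform /D; field.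
have p1 : 0 <= s * qform x - x.1 ^+ 2 by rewrite e1 divr_ge0 ?sqr_ge0// ltW.
have p2 : 0 <= w * qform x - x.2 ^+ 2 by rewrite e2 divr_ge0 ?sqr_ge0// ltW.
by rewrite mulrDl; lra.
Qed.

Lemma measurable_gauss_pdf_EFin :
  measurable_fun [set: plane R] (fun x => (gauss_pdf S x)%:E).
Proof. by apply/measurable_EFinP; exact: measurable_gauss_pdf. Qed.

Lemma ge0_gauss_integral (f : plane R -> \bar R) : measurable_fun setT f ->
  (forall x, (0 <= f x)%E) ->
  (\int[gauss_measure S]_x f x = \int[leb2]_x (f x * (gauss_pdf S x)%:E))%E.
Proof.
move=> mf f0; apply: ge0_integral_density => //.
- exact: gauss_pdf_ge0.
- exact: measurable_gauss_pdf.
Qed.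

Lemma gauss_integral_fst (f : R -> R) : measurable_fun setT f ->
  (forall x, 0 <= f x) ->
  (\int[gauss_measure S]_x (f x.1)%:E =
   \int[mu]_x (f x * normal_pdf 0 (Num.sqrt s) x)%:E)%E.
Proof.
move=> mf f0.
have mf1 : measurable_fun [set: plane R] (fun x => (f x.1)%:E).
  by apply/measurable_EFinP; exact: (measurableT_comp mf).
rewrite ge0_gauss_integral//; last by move=> x; rewrite lee_fin.
rewrite /leb2 fubini_tonelli1//=; last 2 first.
- by apply: emeasurable_funM => //; exact: measurable_gauss_pdf_EFin.
- by move=> x; rewrite mule_ge0// lee_fin// gauss_pdf_ge0.
apply: eq_integral => x _.
rewrite /fubini_F/=.
under eq_integral => y _ do rewrite gauss_pdf_disintegrate/= -EFinM mulrA EFinM.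
rewrite ge0_integralZl//.
- by rewrite integral_normal_pdf mule1.
- by apply/measurable_EFinP; exact: measurable_normal_pdf.
- by move=> y _; rewrite lee_fin normal_pdf_ge0.
- by rewrite lee_fin mulr_ge0// normal_pdf_ge0.
Qed.

Lemma gauss_measureT : gauss_measure S setT = 1%E.
Proof.
transitivity (\int[gauss_measure S]_x (1%:E : \bar R))%E.
  by rewrite integral_cst// mul1e.
rewrite (@gauss_integral_fst (cst 1))//.
by under eq_integral do rewrite mul1r; rewrite integral_normal_pdf.
Qed.

End gauss.

Section moments.
Context {R : realType}.
Implicit Types (x : plane R).

Definition sqn x : R := x.1 ^+ 2 + x.2 ^+ 2.

Lemma sqn_ge0 x : 0 <= sqn x. Proof. by rewrite addr_ge0 ?sqr_ge0. Qed.

Lemma measurable_fst1 : measurable_fun setT (fun x => x.1).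
Proof. exact: measurable_fst. Qed.

Lemma measurable_lin (v1 v2 : R) :
  measurable_fun setT (fun x => v1 * x.1 + v2 * x.2).
Proof.
by apply: measurable_funD; apply: measurable_funM.
Qed.

Lemma measurable_sqn : measurable_fun setT sqn.
Proof.
by apply: measurable_funD; apply: measurable_funX.
Qed.

Variables (s u w : R).
Hypotheses (s0 : 0 < s) (D0 : 0 < s * w - u * u).
Let S := mx2 s u u w.

Lemma qform_ge0 x : 0 <= qform s u w x.
Proof.
have := le_trans (sqn_ge0 x) (qform_ub D0 x); rewrite pmulr_rge0//.
have : 0 < s * w by have := sqr_ge0 u; rewrite expr2; have := D0; lra.
by rewrite pmulr_rgt0// => w0; rewrite addr_gt0.
Qed.

(** Half of the exponential decay absorbs the polynomial factor: since
    [q^2 <= 32 e^{q/4}], the function [q^2 e^{-q/2}] is at most [32 e^{-q/4}],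
    a multiple of the Gaussian density of twice the covariance. *)
Lemma sqn_sqr_gauss_pdf x : sqn x ^+ 2 * gauss_pdf S x <=
  64 * (s + w) ^+ 2 * gauss_pdf (mx2 (s + s) (u + u) (u + u) (w + w)) x.
Proof.
have D4 : (s + s) * (w + w) - (u + u) * (u + u) = 2 ^+ 2 * (s * w - u * u) by ring.
rewrite !gauss_pdfE//; last by rewrite D4 mulr_gt0.
have q0 := qform_ge0 x; have qub := qform_ub D0 x.
have -> : qform (s + s) (u + u) (w + w) x = qform s u w x / 2.
  by rewrite /qform D4; field; rewrite gt_eqF.
rewrite D4 sqrtrM// sqrtr_sqr ger0_norm//.
set q := qform s u w x in q0 qub *; set r := Num.sqrt _.
rewrite [leRHS](_ : _ = (2 * pi)^-1 * r^-1 * (32 * (s + w) ^+ 2 * expR (- 2^-1 * (q / 2)))); last first.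
  by rewrite (invfM 2 r); move: (2 * pi)^-1 r^-1 => P r1; field.
rewrite mulrCA ler_wpM2l//.
  by rewrite mulr_ge0// invr_ge0// ?sqrtr_ge0// mulr_ge0// pi_ge0.
(* The quadratic term of the exponential series at [q / 4]. *)
have qexp : q ^+ 2 <= 32 * expR (q / 4).
  have := @expR_ge1Dxn _ (q / 4) 1; rewrite divr_ge0// => /(_ isT).
  rewrite (_ : 2`!%:R = 2)// => h.
  rewrite (_ : q ^+ 2 = 32 * ((q / 4) ^+ 2 / 2)); last by field.
  by rewrite ler_pM2l//; lra.
have e : expR (- 2^-1 * (q / 2)) = expR (q / 4) * expR (- 2^-1 * q).
  by rewrite -expRD; congr expR; field.
rewrite e mulrA ler_wpM2r ?expR_ge0//.
rewrite -mulrA [_ * (_ * expR _)]mulrCA.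
apply: (@le_trans _ _ ((s + w) ^+ 2 * q ^+ 2)).
  by rewrite -exprMn lerXn2r// nnegrE ?sqn_ge0// (le_trans (sqn_ge0 x)).
by rewrite ler_wpM2l// sqr_ge0.
Qed.

(** Fourth moments are finite since the Gaussian measure of covariance [2 S] has
    mass one. *)
Lemma integral_sqn_sqr : (\int[gauss_measure S]_x (sqn x ^+ 2)%:E < +oo)%E.
Proof.
have D40 : 0 < (s + s) * (w + w) - (u + u) * (u + u).
  by rewrite (_ : _ - _ = 4 * (s * w - u * u)) ?mulr_gt0//; ring.
have m2 : measurable_fun setT (fun x => (sqn x ^+ 2)%:E).
  by apply/measurable_EFinP; apply: measurable_funX; exact: measurable_sqn.
rewrite ge0_gauss_integral//; last by move=> x; rewrite lee_fin sqr_ge0.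
pose C := 64 * (s + w) ^+ 2.
apply: (@le_lt_trans _ _ (\int[leb2]_x (C%:E *
   (gauss_pdf (mx2 (s + s) (u + u) (u + u) (w + w)) x)%:E))%E).
  apply: ge0_le_integral => //.
  - by move=> x _; rewrite mule_ge0 ?lee_fin ?sqr_ge0 ?gauss_pdf_ge0.
  - by apply: emeasurable_funM => //; exact: measurable_gauss_pdf_EFin.
  - by apply: emeasurable_funM => //; exact: measurable_gauss_pdf_EFin.
  - by move=> x _; rewrite lee_fin; exact: sqn_sqr_gauss_pdf.
rewrite ge0_integralZl//; last 3 first.
- exact: measurable_gauss_pdf_EFin.
- by move=> x _; rewrite lee_fin gauss_pdf_ge0.
- by rewrite lee_fin mulr_ge0// sqr_ge0.
have := @gauss_measureT _ (s + s) (u + u) (w + w).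
by rewrite /gauss_measure => -> //; rewrite ?mule1 ?ltry ?addr_gt0.
Qed.

(** All integrands met below grow at most like the fourth power of the norm. *)
Lemma gauss_integrable (f : plane R -> R) C : measurable_fun setT f ->
  (forall x, `|f x| <= C * (1 + sqn x ^+ 2)) ->
  (gauss_measure S).-integrable setT (EFin \o f).
Proof.
move=> mf fC; apply/integrableP; split; first exact/measurable_EFinP.
have C0 : 0 <= C.
  have := le_trans (normr_ge0 _) (fC (0, 0)).
  by rewrite /sqn/= expr0n/= addr0 expr0n/= addr0 mulr1.
have m2 : measurable_fun setT (fun x => (sqn x ^+ 2)%:E).
  by apply/measurable_EFinP; apply: measurable_funX; exact: measurable_sqn.
apply: (@le_lt_trans _ _ (\int[gauss_measure S]_x (C%:E * (1 + (sqn x ^+ 2)%:E)))%E).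
  apply: ge0_le_integral => //.
  - by apply/measurableT_comp => //; exact/measurable_EFinP.
  - by apply: emeasurable_funM => //; exact: emeasurable_funD.
  - by move=> x _; rewrite /= lee_fin; exact: fC.
have p0 x : (0 <= (sqn x ^+ 2)%:E)%E by rewrite lee_fin sqr_ge0.
rewrite ge0_integralZl//; last 2 first.
- exact: emeasurable_funD.
- by move=> x _; rewrite adde_ge0.
rewrite ge0_integralD//.
have -> : (\int[gauss_measure S]_x (1 : \bar R) = 1)%E.
  by rewrite integral_cst// mul1e; exact: gauss_measureT.
apply: lte_mul_pinfty => //; rewrite lte_add_pinfty ?ltry//.
exact: integral_sqn_sqr.
Qed.

Lemma ge0_leb2_opp (f : plane R -> \bar R) : measurable_fun setT f ->
  (forall x, (0 <= f x)%E) ->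
  (\int[leb2]_x f (- x)%R = \int[leb2]_x f x)%E.
Proof.
move=> mf f0.
have mN : measurable_fun setT (fun x : plane R => - x).
  by apply: measurable_fun_pair; exact: measurable_funN.
rewrite /leb2 !fubini_tonelli1//; last exact: (measurableT_comp mf mN).
rewrite -[RHS](ge0_integral_reflect 0)//; last 2 first.
- exact: measurable_fun_fubini_tonelli_F.
- by move=> x; exact: integral_ge0.
apply: eq_integral => x _; rewrite /fubini_F sub0r.
rewrite -[RHS](ge0_integral_reflect 0)//; last exact: (measurable_fun_pair2 _ mf).
by apply: eq_integral => y _; rewrite sub0r.
Qed.

Lemma ge0_leb2_reflect (k : R) (f : plane R -> \bar R) : measurable_fun setT f ->
  (forall x, (0 <= f x)%E) ->
  (\int[leb2]_x f (x.1, k * x.1 - x.2)%R = \int[leb2]_x f x)%E.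
Proof.
move=> mf f0.
have mN : measurable_fun setT (fun x : plane R => (x.1, k * x.1 - x.2) : plane R).
  apply: measurable_fun_pair; first exact: measurable_fst1.
  have := measurable_lin k (-1).
  by apply: eq_measurable_fun => x _; rewrite mulN1r.
rewrite /leb2 !fubini_tonelli1//; last exact: (measurableT_comp mf mN).
apply: eq_integral => x _; rewrite /fubini_F /=.
rewrite (ge0_integral_reflect (k * x) (f := fun y => f (x, y)))//.
exact: (measurable_fun_pair2 _ mf).
Qed.

(** Applied to the central symmetry, which shows that the measure is centered,
    and to the reflection of the second coordinate about its conditional mean. *)
Lemma ge0_gauss_invariant (tau : plane R -> plane R) : measurable_fun setT tau ->
  (forall f : plane R -> \bar R, measurable_fun setT f -> (forall x, (0 <= f x)%E) ->
    (\int[leb2]_x f (tau x) = \int[leb2]_x f x)%E) ->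
  (forall x, gauss_pdf S (tau x) = gauss_pdf S x) ->
  forall f : plane R -> \bar R, measurable_fun setT f -> (forall x, (0 <= f x)%E) ->
    (\int[gauss_measure S]_x f (tau x) = \int[gauss_measure S]_x f x)%E.
Proof.
move=> mtau inv taupdf f mf f0.
rewrite !ge0_gauss_integral//; last exact: (measurableT_comp mf mtau).
rewrite -[RHS]inv; last 2 first.
- by apply: emeasurable_funM => //; exact: measurable_gauss_pdf_EFin.
- by move=> x; rewrite mule_ge0 ?lee_fin ?gauss_pdf_ge0.
by apply: eq_integral => x _; rewrite taupdf.
Qed.

End moments.

(** * Moments of linear forms *)

Section linear.
Context {R : realType}.
Implicit Types (x y : plane R) (v : R * R).

Definition lin v x : R := v.1 * x.1 + v.2 * x.2.

Lemma linB v x y : lin v (x - y) = lin v x - lin v y.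
Proof. by rewrite /lin/=; ring. Qed.

Lemma lin_sqr_le v x : lin v x ^+ 2 <= sqn v * sqn x.
Proof.
rewrite -subr_ge0 (_ : _ - _ = (v.1 * x.2 - v.2 * x.1) ^+ 2) ?sqr_ge0//.
by rewrite /sqn /lin; ring.
Qed.

Lemma lin4_le v x : lin v x ^+ 2 ^+ 2 <= sqn v ^+ 2 * (1 + sqn x ^+ 2).
Proof.
apply: (@le_trans _ _ ((sqn v * sqn x) ^+ 2)).
  by rewrite lerXn2r ?nnegrE ?sqr_ge0 ?mulr_ge0 ?sqn_ge0 ?lin_sqr_le.
by rewrite exprMn ler_wpM2l ?sqr_ge0// lerDr.
Qed.

Lemma lin2_le v x : lin v x ^+ 2 <= sqn v * (1 + sqn x ^+ 2).
Proof.
apply: (le_trans (lin_sqr_le v x)); rewrite ler_wpM2l ?sqn_ge0//.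
by have := sqr_ge0 (sqn x - 1); have := sqr_ge0 (sqn x); lra.
Qed.

Lemma norm_lin_le v x : `|lin v x| <= (1 + sqn v) * (1 + sqn x ^+ 2).
Proof.
have := lin2_le v x; have := sqr_ge0 (`|lin v x| - 1).
rewrite sqrrB1 real_normK ?num_real//; have := sqr_ge0 (sqn x).
have := normr_ge0 (lin v x); lra.
Qed.

Variables (s u w : R).
Hypotheses (s0 : 0 < s) (D0 : 0 < s * w - u * u).
Let S := mx2 s u u w.
Local Notation gamma := (gauss_measure S).

Lemma measurable_linv v : measurable_fun setT (lin v).
Proof. exact: measurable_lin. Qed.

Lemma integrable_lin v : gamma.-integrable setT (EFin \o lin v).
Proof.
exact: (gauss_integrable s0 D0 (measurable_linv v) (norm_lin_le v)).
Qed.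

Lemma integrable_linM v v' :
  gamma.-integrable setT (EFin \o (fun x => lin v x * lin v' x)).
Proof.
apply: (gauss_integrable s0 D0 (C := sqn v + sqn v')).
  by apply: measurable_funM; exact: measurable_linv.
move=> x; have := lin2_le v x; have := lin2_le v' x.
have := sqr_ge0 (`|lin v x| - `|lin v' x|).
rewrite sqrrB !real_normK ?num_real// -normrM.
have := sqr_ge0 (lin v x); have := sqr_ge0 (lin v' x); rewrite mulrDl; lra.
Qed.

Lemma gauss_integral_lin v : \int[gamma]_x lin v x = 0.
Proof.
rewrite /Rintegral (@integral_odd _ _ _ _ (fun x : plane R => - x))//.
- apply: ge0_gauss_invariant => //; last 2 first.
  + exact: ge0_leb2_opp.
  + move=> x; rewrite !gauss_pdfE//; congr (_ * expR (_ * _)).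
    by rewrite /qform/=; ring.
  by apply: measurable_fun_pair; exact: measurable_funN.
- exact: integrable_lin.
- by move=> x; rewrite -EFinN; congr EFin; rewrite /lin/=; ring.
Qed.

(** The residual of the regression of [x.2] on [x.1] is uncorrelated with
    [x.1]: reflecting [x.2] about [u / s * x.1] preserves the density and changes
    the sign of the residual. *)
Lemma gauss_integral_residual :
  \int[gamma]_x (lin (1, 0) x * lin (- (u / s), 1) x) = 0.
Proof.
(* The reflection of [x.2] about [m] is [2 m - x.2]. *)
pose k := 2 * (u / s).
rewrite /Rintegral (@integral_odd _ _ _ _
  (fun x : plane R => (x.1, k * x.1 - x.2) : plane R))//.
- apply: ge0_gauss_invariant => //; last 2 first.
  + exact: ge0_leb2_reflect.
  + move=> x; rewrite !gauss_pdfE//; congr (_ * expR (_ * _)).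
    by rewrite /qform/= /k; field; rewrite !gt_eqF.
  apply: measurable_fun_pair; first exact: measurable_fst1.
  have := measurable_lin k (-1).
  by apply: eq_measurable_fun => x _; rewrite mulN1r.
- exact: integrable_linM.
- by move=> x; rewrite -EFinN; congr EFin; rewrite /lin/= /k; ring.
Qed.

(** The first marginal is normal, and [r^2] times its density is bounded below
    by a positive constant for [r] in [[1/2, 1]]. *)
Lemma gauss_integral_fst_gt0 : 0 < \int[gamma]_x (lin (1, 0) x * lin (1, 0) x).
Proof.
have finv := integrable_fin_num measurableT (integrable_linM (1, 0) (1, 0)).
apply: fine_gt0; apply/andP; split; last by move: finv; rewrite ltey_eq => ->.
have -> : (\int[gamma]_x (lin (1, 0) x * lin (1, 0) x)%:E =
    \int[lebesgue_measure]_r (r ^+ 2 * normal_pdf 0 (Num.sqrt s) r)%:E)%E.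
  rewrite -(gauss_integral_fst s0 D0 (f := fun r => r ^+ 2))//.
  - by apply: eq_integral => x _; rewrite /lin/=; congr EFin; ring.
  - by move=> x; rewrite sqr_ge0.
set N := normal_pdf 0 (Num.sqrt s).
have N0 (r : R) : 0 <= N r by exact: normal_pdf_ge0.
have s'0 : Num.sqrt s != 0 by rewrite gt_eqF// sqrtr_gt0.
have N1 (x : R) : x \in `[2^-1, 1] -> 4^-1 * N 1 <= x ^+ 2 * N x.
  rewrite in_itv/= => /andP[x2 x1]; apply: ler_pM => //.
    have := sqr_ge0 (x - 2^-1); rewrite sqrrB; lra.
  rewrite /N normal_pdfE// ler_wpM2l ?normal_peak_ge0// ler_expR.
  rewrite !mulNr lerN2 ler_wpM2r ?invr_ge0 ?mulrn_wge0 ?sqr_ge0//.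
  by rewrite !subr0 lerXn2r// ?nnegrE; lra.
apply: (@lt_le_trans _ _ (\int[lebesgue_measure]_(_ in `[2^-1%R, 1%R]) (4^-1 * N 1)%:E)%E).
  rewrite integral_cst//= lebesgue_measure_itv/= lte_fin ifT; last by lra.
  rewrite -EFinB -EFinM lte_fin !mulr_gt0//; last by lra.
  by rewrite /N normal_pdfE// mulr_gt0 ?expR_gt0 ?normal_peak_gt0.
have mN : measurable_fun [set: measurableTypeR R] (fun x : R => (x ^+ 2 * N x)%:E).
  apply/measurable_EFinP/measurable_funM; first exact: measurable_funX.
  exact: measurable_normal_pdf.
apply: (@le_trans _ _ (\int[lebesgue_measure]_(r in `[2^-1%R, 1%R]) (r ^+ 2 * N r)%:E)%E).
  apply: ge0_le_integral => //.
  - by move=> x _; rewrite lee_fin mulr_ge0.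
  - exact: measurable_funTS.
apply: ge0_subset_integral => //.
by move=> x _; rewrite lee_fin mulr_ge0// sqr_ge0.
Qed.

(** A linear form is the sum of a multiple of [x.1] and a multiple of the
    residual. *)
Lemma gauss_integral_fstM v : \int[gamma]_x (lin (1, 0) x * lin v x) =
  (v.1 + v.2 * (u / s)) * \int[gamma]_x (lin (1, 0) x * lin (1, 0) x).
Proof.
have i1 := integrable_linM (1, 0) (1, 0).
have i2 := integrable_linM (1, 0) (- (u / s), 1).
transitivity (\int[gamma]_x
    ((v.1 + v.2 * (u / s)) * (lin (1, 0) x * lin (1, 0) x) +
     v.2 * (lin (1, 0) x * lin (- (u / s), 1) x))).
  by apply: eq_Rintegral => x _; rewrite /lin/=; ring.
rewrite RintegralD//; last 2 first.
- exact: (integrableZl measurableT _ i1).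
- exact: (integrableZl measurableT _ i2).
by rewrite !RintegralZl// gauss_integral_residual mulr0 addr0.
Qed.

End linear.

(** * Real functions in the complex Hilbert space *)

Section L2.
Context {R : realType} (mu : {measure set (plane R) -> \bar R}).
Implicit Types (r P : plane R -> R).

(** The integral of a nonnegative function is a supremum over the simple
    functions below it, so it is monotone even without measurability. Thus
    [OU_Cb t h] need not be shown measurable to estimate its norm. *)
Lemma le_integral_nonmeasurable (f g : plane R -> \bar R) :
  (forall x, 0 <= f x)%E -> (forall x, f x <= g x)%E ->
  (\int[mu]_x f x <= \int[mu]_x g x)%E.
Proof.
move=> f0 fg; have g0 x := le_trans (f0 x) (fg x).
rewrite !ge0_integralTE//; apply: ereal_sup_le => _ [h hf <-].
by exists h => // x; exact: le_trans (hf x) (fg x).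
Qed.

Lemma L2norm_real r :
  L2norm mu (fun x => (r x)%:C) = ((\int[mu]_x (r x ^+ 2)%:E) `^ 2^-1)%E.
Proof.
rewrite /L2norm unlock; congr (_ `^ _)%E; apply: eq_integral => x _.
rewrite /= expr0n/= addr0 sqrtr_sqr normr_id powR_mulrn//.
by rewrite real_normK ?num_real.
Qed.

Lemma inL2_real r : measurable_fun setT r -> mu.-integrable setT (fun x => (r x ^+ 2)%:E) ->
  inL2 mu (fun x => (r x)%:C).
Proof.
move=> mr ir; split => //.
rewrite L2norm_real poweR_lty//.
move/integrableP : ir => [_]; apply: le_lt_trans.
by apply: le_integral_nonmeasurable => x; rewrite ?lee_fin ?sqr_ge0//= ler_norm.
Qed.

Lemma L2norm_cvg0 (I : Type) (F : set_system I) (FF : Filter F)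
    (r : I -> plane R -> R) (e : I -> R) P :
  mu.-integrable setT (fun x => (P x ^+ 2)%:E) ->
  (\forall i \near F, forall x, `|r i x| <= e i * P x) ->
  e i @[i --> F] --> 0 ->
  L2norm mu (fun x => (r i x)%:C) @[i --> F] --> 0%E.
Proof.
move=> iP rP e0; set c := (\int[mu]_x (P x ^+ 2)%:E)%E.
have cfin : c \is a fin_num by exact: integrable_fin_num.
have c0 : 0 <= fine c by apply/fine_ge0/integral_ge0 => x _; rewrite lee_fin sqr_ge0.
apply: (@squeeze_cvge _ _ _ _ (cst 0%E) _ (fun i => (`|e i| * Num.sqrt (fine c))%:E)).
- near=> i; apply/andP; split; first exact: Lnorm_ge0.
  have rPi x : `|r i x| <= e i * P x by move: x; near: i.
  rewrite L2norm_real.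
  have le1 : (\int[mu]_x (r i x ^+ 2)%:E <= (e i ^+ 2)%:E * c)%E.
    rewrite /c -integralZl//; apply: le_integral_nonmeasurable => x.
      by rewrite lee_fin sqr_ge0.
    rewrite -EFinM lee_fin -exprMn -real_normK ?num_real// lerXn2r// ?nnegrE//.
    exact: le_trans (normr_ge0 (r i x)) (rPi x).
  apply: (@le_trans _ _ (((e i ^+ 2)%:E * c) `^ 2^-1)%E).
    have c0' : (0 <= c)%E by rewrite -(fineK cfin) lee_fin.
    apply: gt0_ler_poweR => //; rewrite in_itv/= leey andbT.
      by apply: integral_ge0 => x _; rewrite lee_fin sqr_ge0.
    by rewrite mule_ge0// lee_fin sqr_ge0.
  rewrite -(fineK cfin) -EFinM /= lee_fin powR12_sqrt.
    by rewrite sqrtrM ?sqr_ge0// sqrtr_sqr.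
  by rewrite mulr_ge0// sqr_ge0.
- exact: cvg_cst.
- apply: cvg_EFin; first by near=> i.
  rewrite /comp/= -[0](mul0r (Num.sqrt (fine c))); apply: cvgMr_tmp.
  by rewrite -(@normr0 _ R); apply: cvg_norm.
Unshelve. all: by end_near. Qed.

End L2.

(** * A bounded approximation of linear forms *)

Section damp.
Context {R : realType}.
Implicit Types (e z : R).

(** A bounded continuous truncation of the identity, which it approaches as [e]
    tends to [0] with an error quadratic in [z]. *)
Definition damp e z : R := z / (1 + e * `|z|).

Let den_gt0 e z : 0 < e -> 0 < 1 + e * `|z|.
Proof. by move=> e0; rewrite ltr_wpDr// mulr_ge0// ltW. Qed.

Lemma damp_err e z : 0 < e -> `|damp e z - z| <= e * z ^+ 2.
Proof.
move=> e0; have d0 := den_gt0 z e0.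
have -> : damp e z - z = - (e * (z * `|z|)) / (1 + e * `|z|).
  by rewrite /damp; field; rewrite gt_eqF.
rewrite normrM normrN normfV (gtr0_norm d0) ler_pdivrMr//.
rewrite !normrM normr_id gtr0_norm// -(real_normK (num_real z)) -expr2.
by rewrite ler_peMr ?lerDl ?mulr_ge0 ?sqr_ge0 ?(ltW e0).
Qed.

Lemma damp_le e z : 0 < e -> `|damp e z| <= `|z|.
Proof.
move=> e0; have d0 := den_gt0 z e0.
rewrite /damp normrM normfV (gtr0_norm d0) ler_pdivrMr//.
by rewrite ler_peMr ?lerDl ?mulr_ge0 ?(ltW e0).
Qed.

Lemma damp_bounded e z : 0 < e -> `|damp e z| <= e^-1.
Proof.
move=> e0; have d0 := den_gt0 z e0.
rewrite /damp normrM normfV (gtr0_norm d0) ler_pdivrMr//.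
by rewrite mulrDr mulKf ?gt_eqF// lerDr mulr1 invr_ge0 ltW.
Qed.

Lemma continuous_damp e : 0 < e -> continuous (damp e).
Proof.
move=> e0 z; apply: cvgM; first exact: cvg_id.
apply: cvgV; first by rewrite gt_eqF// den_gt0.
apply: cvgD; first exact: cvg_cst.
by apply: cvgM; [exact: cvg_cst|apply: cvg_norm; exact: cvg_id].
Qed.

Lemma measurable_damp e : 0 < e -> measurable_fun setT (damp e).
Proof. by move=> /continuous_damp; exact: continuous_measurable_fun. Qed.

End damp.

Section gauss_damp.
Context {R : realType}.
Variables (s u w : R).
Hypotheses (s0 : 0 < s) (D0 : 0 < s * w - u * u).
Local Notation gamma := (gauss_measure (mx2 s u u w)).

Lemma integrable_quad v (A C : R) :
  gamma.-integrable setT (fun x => ((A * lin v x ^+ 2 + C) ^+ 2)%:E).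
Proof.
apply: (gauss_integrable s0 D0 (C := 2 * A ^+ 2 * sqn v ^+ 2 + 2 * C ^+ 2)).
  apply: measurable_funX; apply: measurable_funD => //.
  by apply: measurable_funM => //; apply: measurable_funX; exact: measurable_linv.
move=> x; rewrite ger0_norm ?sqr_ge0//.
apply: (@le_trans _ _ (2 * (A * lin v x ^+ 2) ^+ 2 + 2 * C ^+ 2)).
  by have := sqr_ge0 (A * lin v x ^+ 2 - C); lra.
rewrite [leRHS](_ : _ = 2 * (A ^+ 2 * (sqn v ^+ 2 * (1 + sqn x ^+ 2))) +
  2 * (C ^+ 2 * (1 + sqn x ^+ 2))); last by ring.
rewrite exprMn lerD// ler_pM2l//.
  by rewrite ler_wpM2l ?sqr_ge0// lin4_le.
by rewrite ler_peMr ?lerDl ?sqr_ge0.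
Qed.

(** The measure is centered, so [m] is the integral of [m - lin v y], and the
    error of [damp] is integrated. *)
Lemma gauss_integral_damp v (e m : R) : 0 < e ->
  `|\int[gamma]_y damp e (m - lin v y) - m| <=
  e * (2 * m ^+ 2 + 2 * \int[gamma]_y (lin v y * lin v y)).
Proof.
move=> e0.
have gT : gamma setT = 1%E by exact: gauss_measureT.
have icst (r : R) : gamma.-integrable setT (EFin \o cst r).
  apply: (gauss_integrable s0 D0 (C := `|r|)) => // x.
  by rewrite ler_peMr ?lerDl ?sqr_ge0.
have intcst (r : R) : \int[gamma]_y r = r.
  by rewrite Rintegral_cst//= gT/= mulr1.
have il := integrable_lin s0 D0 v.
have im : gamma.-integrable setT (EFin \o (fun y => m - lin v y)).
  exact: (integrableB measurableT (icst m) il).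
have iq : gamma.-integrable setT
    (EFin \o (fun y => 2 * m ^+ 2 + 2 * (lin v y * lin v y))).
  exact: (integrableD measurableT (icst (2 * m ^+ 2))
    (integrableZl measurableT 2 (integrable_linM s0 D0 v v))).
have mdamp : measurable_fun setT (fun y => damp e (m - lin v y)).
  apply: (measurableT_comp (measurable_damp e0)).
  by apply: measurable_funB => //; exact: measurable_linv.
have is' : gamma.-integrable setT (EFin \o (fun y => damp e (m - lin v y))).
  apply: le_integrable im => //; first exact/measurable_EFinP.
  by move=> y _; rewrite /= lee_fin damp_le.
have em : m = \int[gamma]_y (m - lin v y).
  rewrite RintegralB//=; last exact: icst.
  by rewrite intcst gauss_integral_lin// subr0.
rewrite [X in _ - X]em -RintegralB//.
apply: (le_trans (le_normr_Rintegral measurableT _)).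
  exact: (integrableB measurableT is' im).
have -> : e * (2 * m ^+ 2 + 2 * \int[gamma]_y (lin v y * lin v y)) =
    \int[gamma]_y (e * (2 * m ^+ 2 + 2 * (lin v y * lin v y))).
  rewrite RintegralZl// RintegralD//; last 2 first.
  - exact: icst.
  - exact: (integrableZl measurableT 2 (integrable_linM s0 D0 v v)).
  by rewrite intcst RintegralZl//; exact: integrable_linM.
apply: le_Rintegral => //.
- exact: (integrable_norm (integrableB measurableT is' im)).
- exact: (integrableZl measurableT e iq).
move=> y _; apply: (le_trans (damp_err _ e0)); rewrite ler_pM2l//.
by have := sqr_ge0 (m + lin v y); lra.
Qed.
End gauss_damp.

(** * Linear eigenfunctions of the generator *)

Section OUlin.
Context {R : realType}.
Variables (B : 'M[R]_2) (v : R * R) (l : R).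
Hypothesis cov_pd : forall t : \bar R, (0 < t)%E -> exists s u w : R,
  [/\ OU_cov 1%:M B t = mx2 s u u w, 0 < s & 0 < s * w - u * u].
Hypothesis flow : forall (t : R) x,
  lin v (pair2 (expmx (t *: B) *m col2 x)) = expR (l * t) * lin v x.

Local Notation f := (fun x : plane R => (lin v x)%:C).
Local Notation gamma_oo := (OU_gamma 1%:M B +oo%E).

Lemma integrable_quad_oo A C :
  gamma_oo.-integrable setT (fun x => ((A * lin v x ^+ 2 + C) ^+ 2)%:E).
Proof.
rewrite /OU_gamma; have [s [u [w [-> s0 D0]]]] := cov_pd (@ltry _ 0).
exact: integrable_quad.
Qed.

Lemma integrable_sqr_oo k :
  gamma_oo.-integrable setT (fun x => ((k * lin v x) ^+ 2)%:E).
Proof.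
rewrite /OU_gamma; have [s [u [w [-> s0 D0]]]] := cov_pd (@ltry _ 0).
have := integrableZl measurableT (k ^+ 2) (integrable_linM s0 D0 v v).
by apply: eq_integrable => // x _; rewrite -EFinM; congr EFin; ring.
Qed.

Lemma inL2_lin k : inL2 gamma_oo (fun x : plane R => (k * lin v x)%:C).
Proof.
apply: inL2_real; last exact: integrable_sqr_oo.
by apply: measurable_funM => //; exact: measurable_linv.
Qed.

Lemma inL2_lin1 : inL2 gamma_oo f.
Proof.
rewrite (_ : f = fun x : plane R => (1 * lin v x)%:C); first exact: inL2_lin.
by apply/funext => x; rewrite mul1r.
Qed.

Lemma continuous_lin : continuous (lin v : R * R -> R).
Proof.
move=> x; apply: cvgD; (apply: cvgM; first exact: cvg_cst).
  exact: cvg_fst.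
exact: cvg_snd.
Qed.

(** By [flow], the linear form evaluated at [e^{tB} x - y] is a multiple of
    [lin v x] minus [lin v y]. *)
Lemma OU_Cb_real t (h : R -> R) x :
  OU_Cb 1%:M B t (fun y => (h (lin v y))%:C) x =
  (\int[OU_gamma 1%:M B t%:E]_y h (expR (l * t) * lin v x - lin v y))%:C.
Proof.
rewrite /OU_Cb /Cintegral/=; congr (_ +i* _).
  by apply: eq_Rintegral => y _; rewrite linB flow.
by rewrite Rintegral_cst// mul0r.
Qed.

(** The damped forms approximate [lin v] in [L^2(gamma_oo)], and their
    images under the semigroup the form [e^{lt} lin v]: both errors are at most
    [(n + 1)^-1] times a quadratic polynomial. *)
Lemma OU_L2_lin t : 0 < t ->
  OU_L2 1%:M B t f (fun x : plane R => (expR (l * t) * lin v x)%:C).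
Proof.
move=> t0; split; [exact: inL2_lin1|exact: inL2_lin|].
have n0 n : 0 < n.+1%:R^-1 :> R by rewrite invr_gt0.
exists (fun n x => (damp n.+1%:R^-1 (lin v x))%:C); split.
- move=> n; split => /=.
  + move=> x; apply: continuous_comp; first exact: continuous_lin.
    exact: continuous_damp.
  + by move=> x; exact: cvg_cst.
  + exists (n.+1%:R^-1^-1) => x.
    by rewrite /= expr0n/= addr0 sqrtr_sqr damp_bounded.
- rewrite (_ : (fun n => _) = (fun n => L2norm gamma_oo
    (fun x => (damp n.+1%:R^-1 (lin v x) - lin v x)%:C))); last first.
    by apply/funext => n; congr L2norm; apply/funext => x; rewrite rmorphB.
  apply: (@L2norm_cvg0 _ _ _ _ _ _ (fun n => n.+1%:R^-1)
    (fun x => 1 * lin v x ^+ 2 + 0)).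
  + exact: integrable_quad_oo.
  + by near=> n => x; rewrite mul1r addr0 damp_err.
  + exact: cvg_harmonic.
- set E := expR (l * t).
  have t0' : (0 < t%:E)%E by rewrite lte_fin.
  have [s [u [w [cov s0 D0]]]] := cov_pd t0'.
  pose V := \int[gauss_measure (mx2 s u u w)]_y (lin v y * lin v y).
  rewrite (_ : (fun n => _) = (fun n => L2norm gamma_oo
    (fun x => (\int[gauss_measure (mx2 s u u w)]_y
      damp n.+1%:R^-1 (E * lin v x - lin v y) - E * lin v x)%:C))); last first.
    apply/funext => n; congr L2norm; apply/funext => x.
    by rewrite OU_Cb_real /OU_gamma cov rmorphB.
  apply: (@L2norm_cvg0 _ _ _ _ _ _ (fun n => n.+1%:R^-1)
    (fun x => 2 * E ^+ 2 * lin v x ^+ 2 + 2 * V)).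
  + exact: integrable_quad_oo.
  + near=> n => x; rewrite -mulrA -exprMn; exact: gauss_integral_damp.
  + exact: cvg_harmonic.
Unshelve. all: by end_near. Qed.

Lemma cvg_expR_slope :
  t^-1 * (expR (l * t) - 1) - l @[t --> (0:R)^'+] --> (0 : R).
Proof.
pose g (t : R) := expR (l * t).
have dg : is_derive (0 : R) 1 g l.
  apply: is_derive_eq.
  by rewrite mulr0 expR0 mul1r /GRing.scale/= mulr1.
have [dg0 Dg] := dg.
have quot : t^-1 * (expR (l * t) - 1) @[t --> 0^'] --> l.
  rewrite -[X in _ --> X]Dg.
  rewrite (_ : (fun t => _) = (fun t => t^-1 *: ((g \o shift 0) (t *: 1) - g 0))).
    exact: dg0.
  by apply/funext => t; rewrite /g/= addr0 mulr0 expR0 /GRing.scale/= mulr1.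
rewrite -[X in _ --> X](subrr l); apply: cvgB; last exact: cvg_cst.
exact: cvg_dnbhs_at_right.
Qed.

(** The difference quotient of the semigroup minus [l * lin v] is the scalar
    [(e^{lt} - 1) / t - l] times [lin v]. *)
Lemma OU_operator_lin : OU_operator 1%:M B f (fun x => l%:C * f x).
Proof.
have gE : (fun x => l%:C * f x) = (fun x : plane R => (l * lin v x)%:C).
  by apply/funext => x; rewrite rmorphM.
rewrite gE; split; [exact: inL2_lin1|exact: inL2_lin|].
exists (fun t x => (expR (l * t) * lin v x)%:C); split; first exact: OU_L2_lin.
pose e t : R := t^-1 * (expR (l * t) - 1) - l.
rewrite (_ : (fun t => _) = (fun t => L2norm gamma_oo
    (fun x => (e t * lin v x)%:C))); last first.
  apply/funext => t; congr L2norm; apply/funext => x.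
  by rewrite -rmorphB -rmorphM -rmorphB; congr _%:C; rewrite /e; ring.
apply: (@L2norm_cvg0 _ _ _ _ _ _ (fun t => `|e t|) (fun x => `|1 * lin v x|)).
- have := integrable_sqr_oo 1; apply: eq_integrable => // x _.
  by rewrite real_normK ?num_real.
- by near=> t => x; rewrite normrM mul1r.
- by rewrite -[X in _ --> X](@normr0 _ R); apply: cvg_norm; exact: cvg_expR_slope.
Unshelve. all: by end_near. Qed.
End OUlin.

(** * Two eigenfunctions that are not orthogonal *)

Section eigen.
Context {R : realType} (mu : {measure set (plane R) -> \bar R}).
Implicit Types (u : plane R -> R[i]) (r : plane R -> R).

Lemma gen_eigenspace_eigenfunction A (m : R[i]) u : inL2 mu u -> nonzero mu u ->
  A u (fun x => m * u x) -> gen_eigenspace mu A m u.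
Proof.
move=> uL2 u0 Au; split=> //; exists 1%N, (fun=> 1), (fun=> u); split.
  move=> _; split=> //; exists 1%N; split=> //=.
  exists (fun x => m * u x); split=> //.
  rewrite (_ : (fun x => _) = (fun x : plane R => (0 : R)%:C)).
    split; last by apply: nearW => x; rewrite subrr.
    by apply: inL2_real => //; under eq_fun do rewrite expr0n; exact: integrable0.
  by apply/funext => x; rewrite subrr.
by apply: nearW => x; rewrite big_ord1 mul1r.
Qed.

Lemma inner_real r r' : inner mu (fun x => (r x)%:C) (fun x => (r' x)%:C) =
  (\int[mu]_x (r x * r' x))%:C.
Proof.
rewrite /inner /Cintegral; congr (_ +i* _).
  by apply: eq_Rintegral => x _; rewrite /= oppr0 mulr0 subr0.
under eq_Rintegral do rewrite /= oppr0 mulr0 mul0r addr0.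
by rewrite Rintegral_cst// mul0r.
Qed.

(** A function that vanishes almost everywhere is orthogonal to every other. *)
Lemma nonzero_real r r' : measurable_fun setT r -> measurable_fun setT r' ->
  \int[mu]_x (r x * r' x) != 0 -> nonzero mu (fun x => (r x)%:C).
Proof.
move=> mr mr' /eqP rr' r0; apply: rr'; rewrite /Rintegral.
rewrite (ae_eq_integral (cst 0%E))//; first by rewrite integral0.
  by apply/measurable_EFinP; exact: measurable_funM.
apply: filterS r0 => x [rx0] _.
by rewrite rx0 mul0r.
Qed.

End eigen.

Section low.
Context {R : realType}.
Variables (p q k : R).
Hypotheses (p0 : p < 0) (q0 : q < 0).
Let B := lowmx p q k.

Lemma low_flow1 (t : R) x :
  lin (1, 0) (pair2 (expmx (t *: B) *m col2 x)) = expR (p * t) * lin (1, 0) x.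
Proof.
rewrite expmx_low /pair2 /lin/= !mxE !big_ord_recl !big_ord0 !mxE/=; ring.
Qed.

Lemma low_flow2 (t : R) x :
  lin (- k, 1) (pair2 (expmx (t *: B) *m col2 x)) = expR (q * t) * lin (- k, 1) x.
Proof.
rewrite expmx_low /pair2 /lin/= !mxE !big_ord_recl !big_ord0 !mxE/=; ring.
Qed.

Lemma low_cov_pd (t : \bar R) : (0 < t)%E -> exists s u w : R,
  [/\ OU_cov 1%:M B t = mx2 s u u w, 0 < s & 0 < s * w - u * u].
Proof.
move=> t0; have pp : p + p < 0 by have := p0; lra.
rewrite OU_cov_low//; do 3 eexists; split; first reflexivity.
  exact: expint_gt0.
by rewrite -expr2; exact: OU_cov_det.
Qed.

(** The regression coefficient of [x.2] on [x.1] is [k (G - H) / G], hence that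
    of [x.2 - k x.1] is [- k H / G]. *)
Lemma integral_low_eigenfunctions_neq0 : k != 0 ->
  \int[OU_gamma 1%:M B +oo%E]_x (lin (1, 0) x * lin (- k, 1) x) != 0.
Proof.
move=> k0; rewrite /OU_gamma OU_cov_low//.
have oo0 : (0 < +oo :> \bar R)%E by [].
have D0 := OU_cov_det k oo0 p0 q0.
have G0 : 0 < expint +oo%E (p + p) by rewrite expint_gt0//; have := p0; lra.
have H0 : 0 < expint +oo%E (p + q) by rewrite expint_gt0//; have := p0; have := q0; lra.
rewrite /= expr2 in D0; rewrite (gauss_integral_fstM G0 D0)/= mulf_neq0//; last first.
  by rewrite gt_eqF// gauss_integral_fst_gt0.
set G := expint _ (p + p) in G0 *; set H := expint _ (p + q) in H0 *.
rewrite (_ : _ + _ = - k * H / G); last by field; rewrite gt_eqF.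
by rewrite !mulf_neq0 ?oppr_eq0 ?invr_eq0// gt_eqF.
Qed.

End low.

Theorem mainTheorem3 (R : realType) (a d c : R)
    (hd : 0 < d) (hda : d < a) (hc : c != 0) :
  let B : 'M[R]_2 := mx2 (- a + d) 0 c (- a - d) in
  let L := OU_operator 1%:M B in
  let gamma_oo := OU_gamma 1%:M B +oo%E in
  exists mu1 mu2 : R[i],
    [/\ mu1 <> mu2,
        is_eigenvalue gamma_oo L mu1,
        is_eigenvalue gamma_oo L mu2 &
        ~ orthogonal_subspaces gamma_oo
            (gen_eigenspace gamma_oo L mu1) (gen_eigenspace gamma_oo L mu2)].
Proof.
move=> B L gamma_oo.
pose p := - a + d; pose q := - a - d; pose k := c / (2 * d).
have p0 : p < 0 by rewrite /p; lra.
have q0 : q < 0 by rewrite /q; lra.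
have k0 : k != 0 by rewrite mulf_neq0// invr_eq0 mulf_neq0// gt_eqF.
have BE : B = lowmx p q k.
  by rewrite /B /lowmx; f_equal; rewrite /k /p /q; field; rewrite gt_eqF.
rewrite /gamma_oo /L {}BE => {B L gamma_oo}.
set B := lowmx p q k; set gamma := OU_gamma 1%:M B +oo%E.
have cov_pd := low_cov_pd k p0 q0.
pose f1 x := (lin ((1, 0) : R * R) x)%:C; pose f2 x := (lin (- k, 1) x)%:C.
have L1 : OU_operator 1%:M B f1 (fun x => p%:C * f1 x).
  by apply: OU_operator_lin => //; exact: low_flow1.
have L2 : OU_operator 1%:M B f2 (fun x => q%:C * f2 x).
  by apply: OU_operator_lin => //; exact: low_flow2.
have f1L2 : inL2 gamma f1 by exact: inL2_lin1.
have f2L2 : inL2 gamma f2 by exact: inL2_lin1.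
have northo := integral_low_eigenfunctions_neq0 p0 q0 k0.
have f10 : nonzero gamma f1 by apply: nonzero_real northo; exact: measurable_linv.
have f20 : nonzero gamma f2.
  apply: (@nonzero_real _ _ _ (lin (1, 0))); [exact: measurable_linv..|].
  by under eq_Rintegral do rewrite mulrC.
exists p%:C, q%:C; split.
- by move=> [] /eqP; rewrite /p /q; apply/negP/eqP; lra.
- by exists f1.
- by exists f2.
move=> /(_ f1 f2 (gen_eigenspace_eigenfunction f1L2 f10 L1)
  (gen_eigenspace_eigenfunction f2L2 f20 L2)).
rewrite inner_real => -[] /eqP; exact/negP.
Qed.
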